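(* Let $\tau_L,\tau_R,\delta_R\in\mathbb{R}$ with $\delta_R>1$ and $\delta_R>\frac{\tau_R^2}{4}$. Then there exists a unique irreducible fraction $\frac{m}{p}\in\left[\frac{1}{n^*+1},\frac{1}{n^*}\right)$, independent of $\tau_L$, such that for all $n\ge 1$ the set $I_n$ is non-empty if and only if $n\in D[m,p;n^*]$. Moreover, the non-empty sets $I_n$ cover $(-\infty,1]$ and are ordered by $D[m,p;n^*]$ (that is, if $n$ appears before $n'$ in the list $D[m,p;n^*]$ then every element of $I_n$ is less than every element of $I_{n'}$).
   Context: For real parameters $\tau_L,\tau_R,\delta_R$ define $f:\mathbb{R}^2\to\mathbb{R}^2$ by $f(x,y)=(\tau_L x+y+1,\,0)$ if $x\le 0$ and $f(x,y)=(\tau_R x+y+1,\,-\delta_R x)$ if $x\ge 0$. Subscripts $1,2$ denote the first and second components of a point of $\mathbb{R}^2$. For $x\in\mathbb{R}$ the return time $N(x)$ is the smallest $n\ge 1$ for which $f^n(x,0)_2=0$, if such $n$ exists. For $n\ge 1$ let $I_n=\{x\in(-\infty,1] : N(x)=n\}$. Let $n^*=N(1)$ (which is well-defined under the stated hypotheses and does not depend on $\tau_L$). A fraction $\frac{m}{p}$ is irreducible if $m,p$ are integers with no common factors and $p\ge 1$ (so $\frac01$ and $\frac11$ are irreducible). For any irreducible $\frac{m}{p}\in(0,1)$ there are unique irreducible fractions $\frac{m^-}{p^-}<\frac{m^+}{p^+}$ in $[0,1]$ with $m^+p^--m^-p^+=1$, $m^-+m^+=m$ and $p^-+p^+=p$;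 these are the left parent and right parent of $\frac{m}{p}$, respectively. Denominator list: given $n^*\ge 1$ and an irreducible $\frac{m}{p}\in\left(0,\frac{1}{n^*}\right)$, let $\frac{m_1^-}{p_1^-}$ be the left parent of $\frac mp$, $\frac{m_2^-}{p_2^-}$ the left parent of $\frac{m_1^-}{p_1^-}$, and so on until $\frac{m_s^-}{p_s^-}=\frac01$; let $\frac{m_1^+}{p_1^+}$ be the right parent of $\frac mp$, $\frac{m_2^+}{p_2^+}$ the right parent of $\frac{m_1^+}{p_1^+}$, and so on until $\frac{m_t^+}{p_t^+}=\frac{1}{n^*}$. Then $D[m,p;n^*]=(p_s^-,\ldots,p_2^-,p_1^-,p,p_1^+,p_2^+,\ldots,p_t^+)$. *)

(* Defs.v *)
From HB Require Import structures.
From mathcomp Require Import all_boot all_order all_algebra.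
From mathcomp Require Import all_classical all_reals.
Set Implicit Arguments.
Unset Strict Implicit.
Unset Printing Implicit Defensive.
Import Order.TTheory GRing.Theory Num.Theory.
Local Open Scope classical_set_scope.
Local Open Scope ring_scope.

(* The two branches agree on the switching line x = 0. *)
Definition pwl_map (R : realType) (tauL tauR deltaR : R) (z : R * R) : R * R :=
  if z.1 <= 0 then (tauL * z.1 + z.2 + 1, 0)
  else (tauR * z.1 + z.2 + 1, - deltaR * z.1).

(* N(x) is a partial function, so [return_time tauL tauR deltaR x n] is the
   relation "N(x) is defined and equal to n". *)
Definition return_time (R : realType) (tauL tauR deltaR x : R) (n : nat) : Prop :=
  [/\ (0 < n)%N,
      (iter n (pwl_map tauL tauR deltaR) (x, 0)).2 = 0 &
      forall k : nat, (0 < k < n)%N ->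
        (iter k (pwl_map tauL tauR deltaR) (x, 0)).2 <> 0].

Definition return_set (R : realType) (tauL tauR deltaR : R) (n : nat) : set R :=
  [set x | x <= 1 /\ return_time tauL tauR deltaR x n].

(* A fraction m/p is the pair (m, p). Only fractions in [0,1] occur, so the
   numerators are natural numbers. *)
Definition fraction : Type := (nat * nat)%type.

Definition irreducible_fraction (q : fraction) : Prop :=
  (0 < q.2)%N /\ coprime q.1 q.2.

Definition fraction_val (q : fraction) : rat := q.1%:R / q.2%:R.

Definition parents (q l r : fraction) : Prop :=
  [/\ irreducible_fraction q /\ 0 < fraction_val q < 1,
      irreducible_fraction l /\ irreducible_fraction r,
      [/\ 0 <= fraction_val l, fraction_val l < fraction_val r
        & fraction_val r <= 1],
      (r.1%:Z * l.2%:Z - l.1%:Z * r.2%:Z = 1) &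
      (l.1 + r.1 = q.1)%N /\ (l.2 + r.2 = q.2)%N].

Definition left_parent (q l : fraction) : Prop := exists r, parents q l r.
Definition right_parent (q r : fraction) : Prop := exists l, parents q l r.

(* [ancestors parent stop q s]: s lists the successive ancestors of q (q itself
   excluded, nearest first), up to and including the first one equal to stop. *)
Inductive ancestors (parent : fraction -> fraction -> Prop) (stop : fraction) :
    fraction -> seq fraction -> Prop :=
  | ancestors_stop : ancestors parent stop stop [::]
  | ancestors_step (q q' : fraction) (s : seq fraction) :
      q <> stop -> parent q q' -> ancestors parent stop q' s ->
      ancestors parent stop q (q' :: s).

(* [denominator_list q nstar D]: D is the list D[m,p;nstar] for q = (m,p). *)
Definition denominator_list (q : fraction) (nstar : nat) (D : seq nat) : Prop :=
  exists ls rs : seq fraction,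
    [/\ ancestors left_parent (0, 1)%N q ls,
        ancestors right_parent (1, nstar)%N q rs &
        D = rev [seq l.2 | l <- ls] ++ q.2 :: [seq r.2 | r <- rs]].

(* The irreducible fractions in [1/(nstar+1), 1/nstar). *)
Definition admissible_fraction (nstar : nat) (q : fraction) : Prop :=
  irreducible_fraction q /\
  fraction_val (1, nstar.+1)%N <= fraction_val q < fraction_val (1, nstar)%N.

Definition lists_return_times (R : realType) (tauL tauR deltaR : R)
    (D : seq nat) : Prop :=
  forall n : nat, (0 < n)%N ->
    (return_set tauL tauR deltaR n !=set0 <-> n \in D).

(* Main.v *)
(* On x > 0 the map is affine with a complex pair of multipliers lambda, lambda^*
   of modulus > 1, so N(x) is the first n at which the affine function
   g_n(x) = (n-th abscissa of the spiralling orbit) is nonpositive. Up to positive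
   factors g_n(x) is the position of lambda^n relative to a line through 1
   whose direction depends affinely on x, and the zero of g_n is the line through
   1 and lambda^n. Hence the points x not yet returned at a given time form an
   interval whose ends are the zeros of g_p and g_q, where lambda^p and lambda^q
   are the neighbours of 1 on the convex hull of the powers so far. The next
   power to leave the cone spanned at 1 by lambda^p and lambda^q is
   lambda^(p+q): it cuts the interval on the left, on the right, or exhausts it.
   This is a descent in the Stern-Brocot tree starting from 0/1 and 1/n*, and it
   stops because an expanding spiral cannot stay on one side of a line. *)
Require Import Defs.
From mathcomp Require Import all_boot all_order all_algebra.
From mathcomp Require Import all_classical all_reals.
From mathcomp Require Import ring lra zify.
Set Implicit Arguments.
Unset Strict Implicit.
Unset Printing Implicit Defensive.
Import Order.TTheory GRing.Theory Num.Theory.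
Local Open Scope classical_set_scope.
Local Open Scope ring_scope.

(** * Powers of lambda, their chords from 1, and cones spanned by two chords *)

Definition cross {R : realFieldType} (a b : R * R) : R := a.1 * b.2 - a.2 * b.1.

Lemma crossC (R : realFieldType) (a b : R * R) : cross a b = - cross b a.
Proof. by rewrite /cross; ring. Qed.

(* Pluecker relation. *)
Lemma cross_mul_gt0 (R : realFieldType) (a b c d : R * R) :
  0 < cross a b -> 0 < cross c d -> 0 < cross a d -> 0 < cross b c ->
  0 < cross a c * cross b d.
Proof.
move=> ab cd ad bc.
suff -> : cross a c * cross b d = cross a b * cross c d + cross a d * cross b c.
  by apply: addr_gt0; apply: mulr_gt0.
by rewrite /cross; ring.
Qed.

(* lambda^n = A n + i sqrt(kappa) c n; working with c instead of the imaginary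
   part avoids the square root, and complex conjugation becomes c |-> - c. *)
Record spiral (R : realFieldType) (kappa : R) (A c : nat -> R) : Prop := Spiral {
  spiral_kappa : 0 < kappa;
  spiral_A0 : A 0 = 1;
  spiral_c0 : c 0 = 0;
  spiral_AD : forall m n, A (m + n)%N = A m * A n - kappa * (c m * c n);
  spiral_cD : forall m n, c (m + n)%N = A m * c n + c m * A n;
  spiral_norm : forall n, (0 < n)%N -> 1 < A n ^+ 2 + kappa * c n ^+ 2 }.

Definition chord {R : realFieldType} (A c : nat -> R) (n : nat) : R * R :=
  (A n - 1, c n).

(* lambda^-n - 1, scaled by |lambda|^(2n). *)
Definition back_chord {R : realFieldType} (kappa : R) (A c : nat -> R) (n : nat) :
    R * R :=
  (A n - (A n ^+ 2 + kappa * c n ^+ 2), - c n).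

(* All lambda^k with 0 < k < p + q lie in the cone at 1 spanned by
   lambda^p - 1 and lambda^q - 1. *)
Definition cone {R : realFieldType} (A c : nat -> R) (p q : nat) : Prop :=
  [/\ 0 < c p, c q < 0, 0 < cross (chord A c p) (chord A c q),
      forall k, (0 < k < p + q)%N -> k != p ->
        0 < cross (chord A c p) (chord A c k) &
      forall k, (0 < k < p + q)%N -> k != q ->
        0 < cross (chord A c k) (chord A c q)].

Section Spirals.
Variables (R : realFieldType) (kappa : R).
Implicit Types (A c : nat -> R).

Lemma spiral_conj A c : spiral kappa A c -> spiral kappa A (fun n => - c n).
Proof.
case=> k0 A0 c0 AD cD nm; split=> //.
- by rewrite c0 oppr0.
- by move=> m n; rewrite AD; ring.
- by move=> m n; rewrite cD; ring.
- by move=> n /nm; rewrite sqrrN.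
Qed.

Lemma cross_chordN A c m n :
  cross (chord A (fun k => - c k) m) (chord A (fun k => - c k) n) =
  cross (chord A c n) (chord A c m).
Proof. by rewrite /cross /chord /=; ring. Qed.

(** Complex conjugation reverses orientation and so exchanges the two sides of a cone. Facts about
    the right side are obtained in this way from those about the left. *)
Lemma cone_conj A c p q : cone A c p q -> cone A (fun n => - c n) q p.
Proof.
case=> cp cq pq pk kq; split.
- by rewrite oppr_gt0.
- by rewrite oppr_lt0.
- by rewrite cross_chordN.
- by move=> k kpq kp; rewrite cross_chordN; apply: kq => //; rewrite addnC.
- by move=> k kpq kp; rewrite cross_chordN; apply: pk => //; rewrite addnC.
Qed.

Lemma cone_conjK A c p q : cone A (fun n => - c n) q p -> cone A c p q.
Proof.
have cK : (fun n => - - c n) = c by apply: boolp.funext => n; rewrite opprK.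
by move=> /cone_conj /=; rewrite cK.
Qed.

Lemma cone_gt0 A c p q : spiral kappa A c -> cone A c p q -> (0 < p)%N /\ (0 < q)%N.
Proof.
move=> sp [cp cq _ _ _]; split; rewrite lt0n; apply/eqP => E.
  by move: cp; rewrite E (spiral_c0 sp) ltxx.
by move: cq; rewrite E (spiral_c0 sp) ltxx.
Qed.

(** Re lambda^n <= |lambda^n| < |lambda^n|^2, because |lambda^n| > 1. *)
Lemma spiral_re_lt A c n : spiral kappa A c -> (0 < n)%N ->
  A n < A n ^+ 2 + kappa * c n ^+ 2.
Proof.
move=> sp n0; have nm := spiral_norm sp n0; have k0 := spiral_kappa sp.
have kc : 0 <= kappa * c n ^+ 2 by rewrite mulr_ge0 ?sqr_ge0 // ltW.
by nra.
Qed.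

(** Multiplication by lambda^-p carries the triangle 1, lambda^p, lambda^(p+q) to lambda^-p, 1,
    lambda^q and keeps its orientation; the scaling in [back_chord] absorbs the area factor. *)
Lemma cross_back A c p q : spiral kappa A c ->
  cross (chord A c p) (chord A c (p + q)) =
  cross (chord A c q) (back_chord kappa A c p).
Proof.
move=> sp; rewrite /cross /chord /back_chord /= (spiral_AD sp) (spiral_cD sp).
by ring.
Qed.

Lemma cross_back_self A c p : spiral kappa A c -> 0 < c p ->
  0 < cross (chord A c p) (back_chord kappa A c p).
Proof.
move=> sp cp; have k0 := spiral_kappa sp.
rewrite /cross /chord /back_chord /=.
suff -> : (A p - 1) * - c p - c p * (A p - (A p ^+ 2 + kappa * c p ^+ 2)) =
   c p * ((A p - 1) ^+ 2 + kappa * c p ^+ 2).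
  by rewrite mulr_gt0 // ltr_wpDl ?sqr_ge0 // mulr_gt0 // exprn_gt0.
by ring.
Qed.

Lemma cross_back_selfN A c q : spiral kappa A c -> c q < 0 ->
  0 < cross (back_chord kappa A c q) (chord A c q).
Proof.
move=> sp cq; have := @cross_back_self A (fun n => - c n) q (spiral_conj sp).
rewrite oppr_gt0 => /(_ cq); congr (0 < _).
by rewrite /cross /chord /back_chord /=; ring.
Qed.

(** Multiplication by lambda^(p+q) carries 1, lambda^-p, lambda^-(p+q) to lambda^(p+q), lambda^q, 1,
    with the same orientation. *)
Lemma cross_back_back A c p q : spiral kappa A c ->
  cross (back_chord kappa A c p) (back_chord kappa A c (p + q)) =
  (A p ^+ 2 + kappa * c p ^+ 2) * cross (chord A c (p + q)) (chord A c q).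
Proof.
move=> sp; rewrite /cross /chord /back_chord /= (spiral_AD sp) (spiral_cD sp).
by ring.
Qed.

(** Writing lambda^p as lambda^(p+q) times the conjugate of lambda^q over |lambda^q|^2 splits the
    cross product into two terms, whose signs follow from Re lambda^n < |lambda^n|^2 at n = q and n
    = p + q. With its mirror image [cone_cut_right], this shows that lambda^(p+q) always leaves the
    cone. *)
Lemma cone_cut_left A c p q : spiral kappa A c -> cone A c p q ->
  0 <= c (p + q)%N -> cross (chord A c p) (chord A c (p + q)) < 0.
Proof.
move=> sp cn cpq; have [p0 q0] := cone_gt0 sp cn; case: cn => _ cq _ _ _.
set D := fun n => A n ^+ 2 + kappa * c n ^+ 2.
have Dq : 0 < D q by apply: lt_trans (spiral_norm sp q0).
rewrite -(pmulr_rlt0 _ Dq).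
have -> : D q * cross (chord A c p) (chord A c (p + q)) =
    c (p + q)%N * (A q - D q) + c q * (D (p + q)%N - A (p + q)%N).
  rewrite /D /cross /chord /= (spiral_AD sp) (spiral_cD sp); ring.
have := spiral_re_lt sp q0; have /(spiral_re_lt sp) : (0 < p + q)%N by lia.
rewrite -/(D q) -/(D (p + q)%N) => h1 h2.
rewrite ltr_wnDl //; first by rewrite mulr_ge0_le0 // subr_le0 ltW.
by rewrite nmulr_rlt0 // subr_gt0.
Qed.

Lemma cone_cut_right A c p q : spiral kappa A c -> cone A c p q ->
  c (p + q)%N <= 0 -> cross (chord A c (p + q)) (chord A c q) < 0.
Proof.
move=> sp cn cpq; rewrite -cross_chordN addnC.
by apply: (cone_cut_left (spiral_conj sp) (cone_conj cn)); rewrite oppr_ge0 addnC.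
Qed.

(** Since lambda^(p+q) stays on the inner side of the ray to lambda^q, it leaves across the ray to
    lambda^p and replaces it. Earlier powers are compared with it by [cross_mul_gt0]; later ones are
    moved back by p + q or by q into the range of the old cone. *)
Lemma cone_left A c p q : spiral kappa A c -> cone A c p q ->
  0 < cross (chord A c (p + q)) (chord A c q) -> cone A c (p + q) q.
Proof.
move=> sp cn Pq; have [p0 q0] := cone_gt0 sp cn.
have cP : 0 < c (p + q)%N.
  rewrite ltNge; apply/negP => /(cone_cut_right sp cn).
  by rewrite ltNge (ltW Pq).
have pP : cross (chord A c p) (chord A c (p + q)) < 0.
  exact: cone_cut_left (ltW cP).
case: cn => cp cq pq pk kq.
set V := chord A c; set U := back_chord kappa A c.
have Pp : 0 < cross (V (p + q)%N) (V p) by rewrite crossC oppr_gt0.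
have Pk k : (0 < k < p + q)%N -> 0 < cross (V (p + q)%N) (V k).
  move=> kpq; have [->//|kp] := eqVneq k p; have [->//|kq'] := eqVneq k q.
  have := cross_mul_gt0 Pp (kq _ kpq kq') Pq (pk _ kpq kp).
  by rewrite pmulr_lgt0.
have Upq : 0 < cross (U p) (V q) by rewrite crossC oppr_gt0 -cross_back.
have PUp : 0 < cross (V (p + q)%N) (U p).
  have := cross_mul_gt0 Pp Upq Pq (cross_back_self sp cp).
  by rewrite pmulr_lgt0.
have UpUP : 0 < cross (U p) (U (p + q)%N).
  rewrite cross_back_back // mulr_gt0 //.
  by apply: lt_trans (spiral_norm sp p0).
split=> // k kpq kP.
- have [kltP|kgeP] := ltnP k (p + q).
    by apply: Pk; rewrite kltP andbT; case/andP: kpq.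
  (* As k < p + 2q, the remainder j is less than q, so the old cone also controls lambda^(p+j). *)
  have [j [kE jq jp]] :
      exists j, [/\ k = (p + q + j)%N, (0 < j < p + q)%N & (0 < p + j < p + q)%N].
    by exists (k - (p + q))%N; clear -kpq kP kgeP p0 q0; split; lia.
  have pj : (p + j != p)%N by clear -jq; lia.
  rewrite kE cross_back //.
  have jUp : 0 < cross (V j) (U p) by rewrite -cross_back //; exact: pk.
  have := cross_mul_gt0 (Pk _ jq) UpUP (cross_back_self sp cP) jUp.
  by rewrite pmulr_rgt0.
- have [kltP|kgtP|->//] := ltngtP k (p + q)%N.
    by apply: kq => //; rewrite kltP andbT; case/andP: kpq.
  (* Here i > p because k > p + q; the case i = q is [UqVq] itself. *)
  have [i [kE ipq ip]] : exists i, [/\ k = (q + i)%N, (0 < i < p + q)%N & i != p].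
    by exists (k - q)%N; clear -kpq kgtP p0 q0; split; lia.
  have Uqp : 0 < cross (U q) (V p).
    by move: Pq; rewrite addnC crossC cross_back // oppr_gt0 crossC oppr_lt0.
  have UqVq := cross_back_selfN sp cq.
  rewrite kE crossC cross_back // oppr_gt0 crossC oppr_lt0.
  have [->//|iq] := eqVneq i q.
  have := cross_mul_gt0 Uqp (kq _ ipq iq) UqVq (pk _ ipq ip).
  by rewrite pmulr_lgt0.
Qed.

Lemma cone_right A c p q : spiral kappa A c -> cone A c p q ->
  0 < cross (chord A c p) (chord A c (p + q)) -> cone A c p (p + q).
Proof.
move=> sp cn pP; apply: cone_conjK; rewrite addnC.
apply: cone_left; [exact: spiral_conj | exact: cone_conj |].
by rewrite cross_chordN addnC.
Qed.

End Spirals.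

(** * Zeros of the affine functions and times of exit *)

Section Root.
Variables (R : realFieldType) (kappa : R) (A c : nat -> R).
Hypothesis sp : spiral kappa A c.

Definition gap (x : R) (n : nat) : R := cross (x, 1) (chord A c n).

Definition gap_zero (n : nat) : R := (A n - 1) / c n.

(** The return time, in the coordinate introduced below as [affine_coord]. *)
Definition exits (x : R) (n : nat) : Prop :=
  [/\ (0 < n)%N, forall k, (0 < k < n)%N -> 0 < gap x k & gap x n <= 0].

Lemma gapE x n : gap x n = 1 - A n + x * c n.
Proof. by rewrite /gap /cross /=; ring. Qed.

Lemma gap_rootE x n : c n != 0 -> gap x n = (x - gap_zero n) * c n.
Proof. by move=> cn; rewrite gapE /gap_zero; field. Qed.

(** Translates the cross products in [cone] into signs of the affine functions at the ends of the
    interval. *)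
Lemma gap_root m n :
  c m != 0 -> gap (gap_zero m) n = cross (chord A c m) (chord A c n) / c m.
Proof. by move=> cm; rewrite gapE /gap_zero /cross /=; field. Qed.

Lemma gap_gt0_pos x n : 0 < c n -> (0 < gap x n) = (gap_zero n < x).
Proof. by move=> cn; rewrite gap_rootE ?gt_eqF // pmulr_lgt0 // subr_gt0. Qed.

Lemma gap_gt0_neg x n : c n < 0 -> (0 < gap x n) = (x < gap_zero n).
Proof. by move=> cn; rewrite gap_rootE ?lt_eqF // nmulr_lgt0 // subr_lt0. Qed.

Lemma gap_le0_pos x n : 0 < c n -> (gap x n <= 0) = (x <= gap_zero n).
Proof. by move=> cn; rewrite leNgt gap_gt0_pos // -leNgt. Qed.

Lemma gap_le0_neg x n : c n < 0 -> (gap x n <= 0) = (gap_zero n <= x).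
Proof. by move=> cn; rewrite leNgt gap_gt0_neg // -leNgt. Qed.

Lemma gap_convex x y z n :
  (z - x) * gap y n = (z - y) * gap x n + (y - x) * gap z n.
Proof. by rewrite !gapE; ring. Qed.

Lemma gap_between_gt0 x y z n : x < y -> y <= z ->
  0 <= gap x n -> 0 < gap z n -> 0 < gap y n.
Proof.
move=> xy yz gx gz; have xz : 0 < z - x by rewrite subr_gt0 (lt_le_trans xy).
rewrite -(pmulr_rgt0 _ xz) gap_convex ltr_wpDl //.
  by rewrite mulr_ge0 // subr_ge0.
by rewrite mulr_gt0 // subr_gt0.
Qed.

Lemma gap_between_le0 x y z n : x < y -> y < z ->
  gap x n <= 0 -> gap z n <= 0 -> gap y n <= 0.
Proof.
move=> xy yz gx gz; have xz : 0 < z - x by rewrite subr_gt0 (lt_trans xy).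
rewrite -(pmulr_rle0 _ xz) gap_convex.
have := mulr_ge0_le0 (ltW (_ : 0 < z - y)) gx; rewrite subr_gt0 => /(_ yz) h1.
have := mulr_ge0_le0 (ltW (_ : 0 < y - x)) gz; rewrite subr_gt0 => /(_ xy) h2.
by rewrite -oppr_ge0 opprD addr_ge0 // oppr_ge0.
Qed.

Section Cone.
Variables (p q : nat).
Hypothesis cn : cone A c p q.

Lemma cone_root_lt : gap_zero p < gap_zero q.
Proof.
case: cn => cp cq pq _ _; rewrite -gap_gt0_neg //.
by rewrite gap_root ?gt_eqF // divr_gt0.
Qed.

Lemma cone_gap_left k : (0 < k < p + q)%N -> k != p -> 0 < gap (gap_zero p) k.
Proof.
case: cn => cp cq _ pk _ kpq kp.
by rewrite gap_root ?gt_eqF // divr_gt0 // pk.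
Qed.

Lemma cone_gap_right k : (0 < k < p + q)%N -> k != q -> 0 < gap (gap_zero q) k.
Proof.
case: cn => cp cq _ _ kq kpq kq'.
rewrite gap_root ?lt_eqF // crossC mulNr -mulrN -invrN divr_gt0 //.
  exact: kq.
by rewrite oppr_gt0.
Qed.

Lemma gap_root_self n : c n != 0 -> gap (gap_zero n) n = 0.
Proof. by move=> cn0; rewrite gap_rootE // subrr mul0r. Qed.

Lemma cone_gap_left_ge0 k : (0 < k < p + q)%N -> 0 <= gap (gap_zero p) k.
Proof.
move=> kpq; have [->|kp] := eqVneq k p; last exact/ltW/cone_gap_left.
by case: cn => cp _ _ _ _; rewrite gap_root_self ?gt_eqF.
Qed.

(** An affine function that is nonnegative at the left end and positive at the right end is positive
    between them. The index q, whose function vanishes at the right end, is settled by the sign of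
    [c q]. *)
Lemma cone_gap k x : (0 < k < p + q)%N -> gap_zero p < x < gap_zero q -> 0 < gap x k.
Proof.
move=> kpq /andP[px xq]; have [->|kq] := eqVneq k q.
  by case: cn => _ cq _ _ _; rewrite gap_gt0_neg.
apply: gap_between_gt0 px (ltW xq) (cone_gap_left_ge0 kpq) _.
exact: cone_gap_right.
Qed.

Lemma cone_exits x n : exits x n -> (p < n)%N -> (q < n)%N -> gap_zero p < x < gap_zero q.
Proof.
have [p0 q0] := cone_gt0 sp cn; case: cn => cp cq _ _ _.
move=> [n0 xn _] pn qn; rewrite -gap_gt0_pos // -gap_gt0_neg //.
by rewrite !xn // ?p0 ?q0.
Qed.

(** Surviving past p and q confines x to the interval of [cone_gap], where no exit occurs before p +
    q. *)
Lemma cone_exits_ge x n :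
  exits x n -> (p < n)%N -> (q < n)%N -> (p + q <= n)%N.
Proof.
move=> xn pn qn; rewrite leqNgt; apply/negP => npq.
case: (xn) => n0 _; apply/negP; rewrite -ltNge.
by apply: cone_gap; rewrite ?n0 // (cone_exits xn).
Qed.

End Cone.

(** The zero of the new affine function lies inside the old interval, so it survives until p + q and
    exits there: the time p + q does occur. *)
Lemma cone_exits_left p q : cone A c (p + q) q -> cone A c p q ->
  gap_zero p < gap_zero (p + q) < gap_zero q /\ exits (gap_zero (p + q)) (p + q).
Proof.
move=> cnL cn; have [p0 q0] := cone_gt0 sp cn.
have lr : gap_zero p < gap_zero (p + q) < gap_zero q.
  rewrite (cone_root_lt cnL) andbT -gap_gt0_pos; last by case: cn.
  by apply: (cone_gap_left cnL); clear -p0 q0; lia.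
split=> //; split=> [|k kpq|]; first by rewrite addn_gt0 p0.
  exact: cone_gap lr.
by rewrite gap_root_self //; case: cnL => cL _ _ _ _; rewrite gt_eqF.
Qed.

Lemma cone_exits_right p q : cone A c p (p + q) -> cone A c p q ->
  gap_zero p < gap_zero (p + q) < gap_zero q /\ exits (gap_zero (p + q)) (p + q).
Proof.
move=> cnL cn; have [p0 q0] := cone_gt0 sp cn.
have lr : gap_zero p < gap_zero (p + q) < gap_zero q.
  rewrite (cone_root_lt cnL) /= -gap_gt0_neg; last by case: cn.
  by apply: (cone_gap_right cnL); clear -p0 q0; lia.
split=> //; split=> [|k kpq|]; first by rewrite addn_gt0 p0.
  exact: cone_gap lr.
by rewrite gap_root_self //; case: cnL => _ cL _ _ _; rewrite lt_eqF.
Qed.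

End Root.

(** * Archimedean bounds, and a common time by which the spiral has crossed the line of every x *)

Lemma archi_mul_gt (R : archiRealFieldType) (e x : R) :
  0 < e -> exists n : nat, x < n%:R * e.
Proof.
move=> e0; exists (Num.bound (`|x| / e)).
rewrite -ltr_pdivrMr //; apply: le_lt_trans (archi_boundP _).
  by rewrite ler_pM2r ?invr_gt0 // ler_norm.
by rewrite divr_ge0 // ltW.
Qed.

Lemma archi_exp_gt (R : archiRealFieldType) (a x : R) :
  1 < a -> exists n : nat, x < a ^+ n.
Proof.
move=> a1; have a0 : 0 < a - 1 by rewrite subr_gt0.
have [n xn] := archi_mul_gt x a0; exists n; apply: lt_le_trans xn _.
suff bernoulli : 1 + n%:R * (a - 1) <= a ^+ n.
  by apply: le_trans bernoulli; rewrite lerDr.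
elim: n => [|n IHn]; first by rewrite mul0r addr0 expr0.
have n0 : 0 <= n%:R :> R by rewrite ler0n.
rewrite exprS -natr1.
have : a * (1 + n%:R * (a - 1)) <= a * a ^+ n by rewrite ler_pM2l //; lra.
apply: le_trans; rewrite -subr_ge0.
suff -> : a * (1 + n%:R * (a - 1)) - (1 + (n%:R + 1) * (a - 1)) =
          n%:R * ((a - 1) * (a - 1)) by rewrite !mulr_ge0 // ltW.
by ring.
Qed.

Lemma spiral_normX (R : realFieldType) (kappa : R) (A c : nat -> R) n :
  spiral kappa A c ->
  A n ^+ 2 + kappa * c n ^+ 2 = (A 1 ^+ 2 + kappa * c 1 ^+ 2) ^+ n.
Proof.
move=> sp; elim: n => [|n IHn].
  by rewrite (spiral_A0 sp) (spiral_c0 sp) expr0; ring.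
by rewrite [RHS]exprS -IHn -add1n (spiral_AD sp) (spiral_cD sp); ring.
Qed.

Section Gap.
Variables (R : archiRealFieldType) (kappa : R) (A c : nat -> R).
Hypotheses (sp : spiral kappa A c) (c1 : 0 < c 1).

(* While all c n are positive, the cotangents A n / c n decrease by a fixed
   amount, yet stay above - A 1 / c 1. *)
Lemma spiral_turns :
  exists n, [/\ (0 < n)%N, 0 < c n & c n.+1 <= 0].
Proof.
suff [n [n0 cn]] : exists n, (0 < n)%N /\ c n <= 0.
  elim: n n0 cn => // -[|n] IHn _ cn; first by move: cn; rewrite leNgt c1.
  have [cn1|cn1] := leP (c n.+1) 0; first exact: IHn.
  by exists n.+1.
apply: boolp.contrapT => noturn.
have cpos n : 0 < c n.+1.
  by rewrite ltNge; apply/negP => cn; apply: noturn; exists n.+1.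
have k0 := spiral_kappa sp.
pose t n := A n.+1 / c n.+1; pose r := t 0%N.
have tr n : 0 < t n + r.
  suff -> : t n + r = c n.+2 / (c n.+1 * c 1) by rewrite divr_gt0 // mulr_gt0.
  rewrite /r /t -[n.+2]addn1 (spiral_cD sp).
  field.
  by rewrite !gt_eqF.
have tS n : t n - t n.+1 = (t n ^+ 2 + kappa) / (t n + r).
  have cS := cpos n.+1; rewrite -[n.+2]addn1 (spiral_cD sp) in cS.
  rewrite /r /t -[n.+2]addn1 (spiral_AD sp) (spiral_cD sp); field.
  by rewrite !gt_eqF // [A 1 * _]mulrC.
have rpos : 0 < r by have := tr 0%N; rewrite -/r; lra.
(* By induction [t n] never exceeds r, so the denominator in [tS] is at most 2r and each drop is at
   least e. *)
pose e := kappa / (2 * r).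
have e0 : 0 < e by rewrite divr_gt0 // mulr_gt0.
have dec n : t n <= r - n%:R * e.
  elim: n => [|n IHn]; first by rewrite mul0r subr0.
  have ne : 0 <= n%:R * e by rewrite mulr_ge0 // ltW.
  suff : e <= t n - t n.+1 by rewrite -natr1; lra.
  rewrite tS; have trn := tr n.
  have le2r : t n + r <= 2 * r by lra.
  apply: (@le_trans _ _ (kappa / (t n + r))).
    by rewrite ler_pM2l // lef_pV2 // posrE // mulr_gt0.
  by rewrite ler_pM2r ?invr_gt0 // lerDr sqr_ge0.
have [n nr] := archi_mul_gt (2 * r) e0.
by have := dec n; have := tr n; lra.
Qed.

(** [1 - gap] is a linear functional u of lambda^k. If u <= 1 for long enough, then u is also
    bounded below, and two consecutive bounded values bound |lambda|^(2m), which grows with m. The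
    bound M is uniform in x, which is what makes the descent terminate. *)
Lemma gap_lt0_bounded :
  exists M, forall x, exists n, (0 < n <= M)%N /\ gap A c x n < 0.
Proof.
have [n [n0 cn cSn]] := spiral_turns.
have k0 := spiral_kappa sp.
pose D1 := A 1 ^+ 2 + kappa * c 1 ^+ 2.
have D1gt1 : 1 < D1 by exact: (spiral_norm sp).
have D1gt0 : 0 < D1 by apply: lt_trans D1gt1.
(* B will bound |u k| for k <= m + 1, and m is taken so large that |lambda|^(2m) exceeds what two
   such values allow. *)
pose B := 1 + (c 1 - c n.+1) / (D1 * c n).
have [m Bm] := archi_exp_gt
  ((c 1 ^+ 2 * kappa * B ^+ 2 + ((`|A 1| + 1) * B) ^+ 2) / (c 1 ^+ 2 * kappa)) D1gt1.
exists (m + n).+2 => x; apply: boolp.contrapT => no.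
pose u k := A k - x * c k.
have u1 k : (k <= (m + n).+2)%N -> u k <= 1.
  case: k => [_|k kM]; first by rewrite /u (spiral_A0 sp) (spiral_c0 sp); lra.
  rewrite leNgt; apply/negP => uk; apply: no; exists k.+1; split=> //.
  by rewrite gapE; move: uk; rewrite /u; lra.
have B1 : 1 <= B.
  by rewrite /B lerDl divr_ge0 ?mulr_ge0 ?subr_ge0 // ltW // (le_lt_trans cSn).
have uB k : (k <= m.+1)%N -> `|u k| <= B.
  move=> km; rewrite ler_norml; apply/andP; split; last first.
    by apply: le_trans B1; apply: u1; clear -km; lia.
  have uk1 : u k.+1 <= 1 by apply: u1; clear -km n0; lia.
  have ukn : u (k + n.+1)%N <= 1 by apply: u1; clear -km n0; lia.
  (* As c n > 0 >= c (n+1), this makes - u k a nonnegative combination of u (k+1) and u (k+n+1),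
     both at most 1. *)
  have id : D1 * c n * u k = c n.+1 * u k.+1 - c 1 * u (k + n.+1)%N.
    rewrite /u /D1 -(addn1 n) addnA -(addn1 k) !(spiral_cD sp) !(spiral_AD sp).
    by rewrite !(spiral_cD sp); ring.
  have Dc : 0 < D1 * c n by rewrite mulr_gt0.
  suff : - ((c 1 - c n.+1) / (D1 * c n)) <= u k by rewrite /B; lra.
  rewrite -mulNr ler_pdivrMr // mulrC id.
  have := ler_wnM2l cSn uk1; have := ler_wpM2l (ltW c1) ukn; lra.
(* The coordinate of lambda^m complementary to u m: the form kappa u^2 + w^2 is a multiple of
   |lambda|^(2m). *)
pose w := kappa * c m + x * A m.
have wE : c 1 * w = A 1 * u m - u m.+1.
  by rewrite /w /u -(addn1 m) (spiral_AD sp) (spiral_cD sp); ring.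
have um := uB m (leqnSn m); have um1 := uB m.+1 (leqnn _).
have B0 : 0 <= B by apply: le_trans B1.
have sq_le (a b : R) : `|a| <= b -> a ^+ 2 <= b ^+ 2.
  move=> ab; rewrite -(real_normK (num_real a)) ler_sqr ?nnegrE //.
  exact: le_trans ab.
have usq := sq_le _ _ um.
have wsq : (c 1 * w) ^+ 2 <= ((`|A 1| + 1) * B) ^+ 2.
  apply: sq_le; rewrite wE mulrDl mul1r (le_trans (ler_normB _ _)) // lerD //.
  by rewrite normrM ler_wpM2l.
have normE : kappa * u m ^+ 2 + w ^+ 2 = (kappa + x ^+ 2) * D1 ^+ m.
  by rewrite -(spiral_normX m sp) /u /w; ring.
have Dm0 : 0 < D1 ^+ m by rewrite exprn_gt0.
have c1k : 0 < c 1 ^+ 2 * kappa by rewrite mulr_gt0 ?exprn_gt0.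
move: Bm; rewrite ltr_pdivrMr // ltNge => /negP; apply.
apply: (@le_trans _ _ (c 1 ^+ 2 * (kappa * u m ^+ 2 + w ^+ 2))).
  rewrite normE -subr_ge0.
  suff -> : c 1 ^+ 2 * ((kappa + x ^+ 2) * D1 ^+ m) - D1 ^+ m * (c 1 ^+ 2 * kappa) =
     (c 1 * x) ^+ 2 * D1 ^+ m by rewrite mulr_ge0 ?sqr_ge0 // ltW.
  by ring.
rewrite mulrDr -exprMn mulrA lerD // ler_wpM2l // ltW //.
Qed.

End Gap.

Lemma mem_insert (T : eqType) (s t : seq T) (x y : T) :
  (y \in rev s ++ x :: t) = (y == x) || (y \in rev s ++ t).
Proof. by rewrite !mem_cat in_cons orbCA. Qed.

(** * Adjacent fractions and their mediants *)

Section Fractions.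
Implicit Types (l r : fraction).

Definition mediant l r : fraction := (l.1 + r.1, l.2 + r.2)%N.

Definition adjacent l r : Prop :=
  [/\ (r.1 * l.2 = (l.1 * r.2).+1)%N, (0 < l.2)%N & (0 < r.2)%N].

Lemma fraction_val_lt l r : (0 < l.2)%N -> (0 < r.2)%N ->
  (fraction_val l < fraction_val r) = (l.1 * r.2 < r.1 * l.2)%N.
Proof.
move=> l0 r0; rewrite /fraction_val ltr_pdivrMr ?ltr0n // mulrAC.
by rewrite ltr_pdivlMr ?ltr0n // -!natrM ltr_nat.
Qed.

Lemma fraction_val_le l r : (0 < l.2)%N -> (0 < r.2)%N ->
  (fraction_val l <= fraction_val r) = (l.1 * r.2 <= r.1 * l.2)%N.
Proof. by move=> l0 r0; rewrite leNgt fraction_val_lt // -leqNgt. Qed.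

Lemma adjacent_coprime l r : adjacent l r -> coprime l.1 l.2 /\ coprime r.1 r.2.
Proof.
move=> [det l0 r0]; have dvd1 d : (d %| r.1 * l.2)%N -> (d %| l.1 * r.2)%N -> d = 1%N.
  by rewrite det => d1 d2; move: d1; rewrite -addn1 dvdn_addr // dvdn1 => /eqP.
by split; apply/eqP; apply: dvd1;
  rewrite ?(dvdn_mulr _ (dvdn_gcdl _ _)) ?(dvdn_mull _ (dvdn_gcdr _ _)).
Qed.

Lemma adjacent_mediantl l r : adjacent l r -> adjacent (mediant l r) r.
Proof.
by case=> det l0 r0; split; rewrite /= ?addn_gt0 ?r0 ?orbT // mulnDr mulnDl det addSn.
Qed.

Lemma adjacent_mediantr l r : adjacent l r -> adjacent l (mediant l r).
Proof.
by case=> det l0 r0; split; rewrite /= ?addn_gt0 ?l0 // mulnDr mulnDl det addnS.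
Qed.

Lemma adjacent_parents l r :
  adjacent l r -> (r.1 <= r.2)%N -> parents (mediant l r) l r.
Proof.
move=> adj r1; have [cl cr] := adjacent_coprime adj.
have [cm _] := adjacent_coprime (adjacent_mediantl adj).
case: adj => det l0 r0.
have val0 q : 0 <= fraction_val q by rewrite divr_ge0 // ler0n.
have l1 : (l.1 < l.2)%N.
  rewrite -(ltn_pmul2r r0); apply: (@leq_trans (r.1 * l.2)); first by rewrite det.
  by rewrite mulnC leq_mul2l r1 orbT.
have rpos : (0 < r.1)%N by case: (r.1) det.
have m2 : (0 < (mediant l r).2)%N by rewrite addn_gt0 l0.
split.
- split; first by [].
  rewrite divr_gt0 ?ltr0n ?addn_gt0 ?rpos ?orbT ?l0 //=.
  rewrite ltr_pdivrMr ?mul1r ?ltr_nat ?ltr0n //= -addSn.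
  by rewrite leq_add.
- by [].
- split; rewrite ?val0 ?fraction_val_lt ?det //.
  by rewrite ler_pdivrMr ?ltr0n // mul1r ler_nat.
- by rewrite -!PoszM det -addn1 PoszD addrC addKr.
- by [].
Qed.

End Fractions.

(** * The descent in the Stern-Brocot tree and its invariant *)

Section Stages.
Variables (R : archiRealFieldType) (kappa : R) (A c : nat -> R).
Hypotheses (sp : spiral kappa A c) (c1 : c 1 = 1).
Local Notation D1 := (A 1 ^+ 2 + kappa * c 1 ^+ 2).

(* The image of the left end [gap_zero 1] of the initial interval under one
   step of the map; it corresponds to x = 1. *)
Definition top_point : R := D1 - A 1.
Local Notation top := top_point.

(** The vector (top, 1) is the negative of [back_chord] at 1, so this is an instance of
    [cross_back]. *)
Lemma gap_top n : gap A c top n = cross (chord A c 1) (chord A c n.+1).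
Proof. by rewrite -add1n (cross_back 1 n sp) gapE /cross /top_point /= c1; ring. Qed.

Variable ns : nat.
Hypothesis ns_exit : exits A c top ns.

Definition precedes (m n : nat) : bool :=
  `[< forall x y, x <= top -> y <= top -> exits A c x m -> exits A c y n -> x < y >].

Definition denominators (s t : seq fraction) : seq nat :=
  rev [seq q.2 | q <- s] ++ [seq q.2 | q <- t].

(** Invariant of the descent: l and r are the current neighbours, [sl] and [sr] their ancestors, and
    the times below l.2 + r.2 that occur are the denominators of all of these. The first alternative
    in [stage_ge] is the start, where l = 0/1; the second says l >= 1/(ns+1). *)
Record stage (l r : fraction) (sl sr : seq fraction) : Prop := Stage {
  stage_adjacent : adjacent l r;
  stage_le : (r.1 * ns <= r.2)%N;
  stage_ge : (l = (0, 1)%N /\ r = (1, ns)%N) \/ (l.2 <= ns.+1 * l.1)%N;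
  stage_left : ancestors left_parent (0, 1)%N l sl;
  stage_right : ancestors right_parent (1, ns)%N r sr;
  stage_cone : cone A c l.2 r.2;
  stage_top : gap_zero A c r.2 <= top;
  stage_nonempty : forall n, n \in denominators (l :: sl) (r :: sr) ->
    exists x, x <= top /\ exits A c x n;
  stage_mem : forall x n, x <= top -> exits A c x n -> (n < l.2 + r.2)%N ->
    n \in denominators (l :: sl) (r :: sr);
  stage_below : forall x n, exits A c x n -> n \in [seq q.2 | q <- l :: sl] ->
    x <= gap_zero A c l.2;
  stage_above : forall x n, exits A c x n -> n \in [seq q.2 | q <- r :: sr] ->
    gap_zero A c r.2 <= x;
  stage_sorted : pairwise precedes (denominators (l :: sl) (r :: sr)) }.

(** At [top] the gap of index 1 equals |lambda - 1|^2 > 0. *)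
Lemma ns_gt1 : (1 < ns)%N.
Proof.
case: ns_exit => n0 _ gn; rewrite ltn_neqAle n0 andbT; apply/eqP => E.
move: gn; rewrite -E gapE c1 /top_point c1 => gn.
have k0 := spiral_kappa sp; have := sqr_ge0 (A 1 - 1); nra.
Qed.

Lemma gap_zero1_lt_top : gap_zero A c 1 < top.
Proof.
rewrite /gap_zero /top_point c1; have k0 := spiral_kappa sp.
have := sqr_ge0 (A 1 - 1); nra.
Qed.

(** By [gap_top], survival of [top] before ns gives the conditions on the side of lambda. Those on
    the other side follow from the Pluecker relation with the vector (top, 1). *)
Lemma initial_cone : cone A c 1 ns.
Proof.
have n1 := ns_gt1; case: ns_exit => n0 topn gn.
have pk k : (0 < k < 1 + ns)%N -> k != 1%N -> 0 < cross (chord A c 1) (chord A c k).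
  case: k => // k kn k1; rewrite -gap_top; apply: topn.
  by clear -kn k1; lia.
have pn : 0 < cross (chord A c 1) (chord A c ns) by apply: pk; clear -n1; lia.
have top1 : 0 < gap A c top 1 by apply: topn.
have zn : 0 < gap A c (gap_zero A c 1) ns.
  by rewrite gap_root ?c1 ?oner_eq0 // divr1.
have cns : c ns < 0.
  have := gap_zero1_lt_top; move: zn gn; rewrite !gapE; nra.
split=> // [|k kn kns]; first by rewrite c1.
have xk : 0 < gap A c top k by apply: topn; clear -kn kns; lia.
have p1k : 0 <= cross (chord A c 1) (chord A c k).
  have [->|k1] := eqVneq k 1%N; last exact/ltW/pk.
  by rewrite /cross mulrC subrr.
rewrite -(pmulr_rgt0 _ top1).
have -> : gap A c top 1 * cross (chord A c k) (chord A c ns) =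
   gap A c top k * cross (chord A c 1) (chord A c ns)
   - gap A c top ns * cross (chord A c 1) (chord A c k).
  by rewrite !gapE /cross /=; ring.
by rewrite ltr_wpDr // ?mulr_gt0 // -mulNr mulr_ge0 // oppr_ge0.
Qed.

Lemma initial_stage : stage (0, 1)%N (1, ns)%N [::] [::].
Proof.
have n1 := ns_gt1; have cn := initial_cone; have lt1 := gap_zero1_lt_top.
have cpos : 0 < c 1 by rewrite c1.
have cns : c ns < 0 by case: cn.
case: (ns_exit) => n0 topn gn.
split=> //=.
- by rewrite mul1n.
- by left.
- exact: ancestors_stop.
- exact: ancestors_stop.
- by rewrite -gap_le0_neg.
- move=> n; rewrite /denominators /= !inE => /orP[] /eqP ->; last by exists top.
  exists (gap_zero A c 1); split; first exact: ltW.
  split=> [//|k|]; first by clear; case: k => [|[|]].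
  by rewrite gap_le0_pos.
- move=> x n xtop [n00 xn gxn] nns; rewrite /denominators /= !inE.
  case: eqVneq => //= nn1; apply: contraT => nneq.
  have x1 : gap_zero A c 1 < x.
    by rewrite -gap_gt0_pos // xn //; clear -n00 nn1; lia.
  suff : 0 < gap A c x n by rewrite ltNge gxn.
  apply: gap_between_gt0 x1 xtop _ _.
    by apply: (cone_gap_left_ge0 cn); clear -n00 nns; lia.
  by apply: topn; clear -n00 nns nneq; lia.
- by move=> x n [_ _ +]; rewrite inE => + /eqP E; rewrite E gap_le0_pos.
- by move=> x n [_ _ +]; rewrite inE => + /eqP E; rewrite E gap_le0_neg.
- rewrite /denominators /= !andbT; apply/boolp.asboolP => x y _ _ [_ _ x1] [_ yn _].
  apply: (@le_lt_trans _ _ (gap_zero A c 1)); first by rewrite -gap_le0_pos.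
  by rewrite -gap_gt0_pos // yn.
Qed.

Section Insert.
Variables (l r : fraction) (sl sr : seq fraction).
Hypothesis st : stage l r sl sr.
Local Notation N := (l.2 + r.2)%N.
Local Notation lo := (gap_zero A c l.2).
Local Notation hi := (gap_zero A c r.2).

Definition inserted : seq nat :=
  denominators (l :: sl) (mediant l r :: r :: sr).

Lemma stage_pos : (0 < l.2)%N /\ (0 < r.2)%N.
Proof. by case: (stage_adjacent st). Qed.

Lemma mem_inserted n :
  (n \in inserted) = (n == N) || (n \in denominators (l :: sl) (r :: sr)).
Proof. exact: mem_insert. Qed.

Lemma exits_mediant x : exits A c x N -> lo < x < hi.
Proof.
have [l0 r0] := stage_pos => xn; apply: (cone_exits sp (stage_cone st) xn).
  by rewrite -[X in (X < _)%N]addn0 ltn_add2l.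
by rewrite -[X in (X < _)%N]add0n ltn_add2r.
Qed.

Lemma inserted_mem x n :
  x <= top -> exits A c x n -> (n <= N)%N -> n \in inserted.
Proof.
move=> xt xn; rewrite mem_inserted leq_eqVlt => /orP[->//|nN].
by rewrite (stage_mem st xt xn) ?orbT.
Qed.

Lemma inserted_nonempty x : lo < x < hi -> exits A c x N ->
  forall n, n \in inserted -> exists x, x <= top /\ exits A c x n.
Proof.
move=> /andP[_ xhi] xN n; rewrite mem_inserted => /orP[/eqP ->|].
  by exists x; split=> //; apply: le_trans (ltW xhi) (stage_top st).
exact: stage_nonempty.
Qed.

(** Points exiting at N lie strictly between [lo] and [hi], which separate the points of the left
    list from those of the right list. *)
Lemma inserted_sorted : pairwise precedes inserted.
Proof.
have := stage_sorted st; rewrite /inserted /denominators !pairwise_cat /=.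
case/and3P => lr ll /andP[rr1 rr]; apply/and3P; split=> //; last first.
  apply/andP; split; last by rewrite rr1.
  have /allP Nr : forall n, n \in [seq q.2 | q <- r :: sr] -> precedes N n.
    move=> n nr; apply/boolp.asboolP => x y _ _ xN yn.
    have /andP[_ xhi] := exits_mediant xN.
    exact: lt_le_trans xhi (stage_above st yn nr).
  exact: Nr.
rewrite allrel_consr; apply/andP; split; last exact: lr.
apply/allP => n; rewrite mem_rev => nl; apply/boolp.asboolP => x y _ _ xn yN.
have /andP[ylo _] := exits_mediant yN.
exact: le_lt_trans (stage_below st xn nl) ylo.
Qed.

Lemma mediant_left_parent : left_parent (mediant l r) l.
Proof.
exists r; apply: adjacent_parents (stage_adjacent st) _.
apply: leq_trans (stage_le st); rewrite leq_pmulr //.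
exact: ltnW ns_gt1.
Qed.

Lemma mediant_right_parent : right_parent (mediant l r) r.
Proof.
exists l; apply: adjacent_parents (stage_adjacent st) _.
apply: leq_trans (stage_le st); rewrite leq_pmulr //.
exact: ltnW ns_gt1.
Qed.

Lemma mediant_left_ancestors :
  ancestors left_parent (0, 1)%N (mediant l r) (l :: sl).
Proof.
apply: ancestors_step mediant_left_parent (stage_left st).
have [l0 r0] := stage_pos.
by move=> -[_ E]; clear -E l0 r0; lia.
Qed.

(** Ensures that the mediant differs from 1/ns, so that its chain of right ancestors does not stop
    at once. *)
Lemma ns_lt_mediant : (ns < N)%N.
Proof.
have [l0 r0] := stage_pos; have := stage_le st.
have [det _ _] := stage_adjacent st.
have r1 : (0 < r.1)%N by case: (r.1) det.
by move=> le; clear -l0 r0 r1 le; nia.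
Qed.

Lemma mediant_right_ancestors :
  ancestors right_parent (1, ns)%N (mediant l r) (r :: sr).
Proof.
apply: ancestors_step mediant_right_parent (stage_right st).
by have := ns_lt_mediant => + [_ E]; rewrite E ltnn.
Qed.

(** The first mediant is 1/(ns+1) itself; afterwards l >= 1/(ns+1) and r > l. *)
Lemma mediant_ge : (N <= ns.+1 * (l.1 + r.1))%N.
Proof.
have [det l0 r0] := stage_adjacent st.
case: (stage_ge st) => [[-> ->] /=|ge]; first by rewrite add0n muln1 add1n.
rewrite mulnDr leq_add // -(leq_pmul2r l0) -mulnA det mulnS.
have : (l.2 * r.2 <= ns.+1 * l.1 * r.2)%N by rewrite leq_mul2r ge orbT.
by rewrite mulnC -mulnA => h; apply: leq_trans h (leq_addl _ _).
Qed.

Lemma mediant_le : ((l.1 + r.1) * ns < N)%N.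
Proof.
have [det l0 r0] := stage_adjacent st; have le := stage_le st.
rewrite mulnDl -addSn leq_add // -(ltn_pmul2r r0).
have : (r.1 * l.2 * ns <= l.2 * r.2)%N by rewrite mulnAC mulnC leq_mul2l le orbT.
rewrite det; move: ns_gt1; clear; nia.
Qed.

Lemma stage_left_step :
  0 < cross (chord A c N) (chord A c r.2) -> stage (mediant l r) r (l :: sl) sr.
Proof.
move=> Nr; have cnL := cone_left sp (stage_cone st) Nr.
have [/andP[lN Nhi] xN] := cone_exits_left sp cnL (stage_cone st).
have dE : denominators (mediant l r :: l :: sl) (r :: sr) = inserted.
  by rewrite /denominators /inserted /= rev_cons cat_rcons.
have [l0 r0] := stage_pos.
split; rewrite ?dE.
- exact: adjacent_mediantl (stage_adjacent st).
- exact: stage_le st.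
- by right; exact: mediant_ge.
- exact: mediant_left_ancestors.
- exact: stage_right st.
- exact: cnL.
- exact: stage_top st.
- by apply: inserted_nonempty xN; rewrite lN.
- move=> x n xt xn; have [nN _|Nn] := leqP n N; first exact: (inserted_mem xt xn nN).
  rewrite ltnNge (cone_exits_ge sp cnL xn) //.
  by apply: leq_ltn_trans Nn; rewrite leq_addl.
- move=> x n xn; rewrite inE => /orP[/eqP nE|nl].
    by case: xn => _ _; rewrite nE gap_le0_pos //; case: cnL.
  exact: le_trans (stage_below st xn nl) (ltW lN).
- exact: stage_above st.
- exact: inserted_sorted.
Qed.

Lemma stage_right_step :
  0 < cross (chord A c l.2) (chord A c N) -> stage l (mediant l r) sl (r :: sr).
Proof.
move=> lN'; have cnR := cone_right sp (stage_cone st) lN'.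
have [/andP[lN Nhi] xN] := cone_exits_right sp cnR (stage_cone st).
have [l0 r0] := stage_pos.
split.
- exact: adjacent_mediantr (stage_adjacent st).
- exact/ltnW/mediant_le.
(* From the initial pair a right step is impossible: its cross product is [gap top ns], which is
   nonpositive. Hence l >= 1/(ns+1) whenever a right step occurs. *)
- case: (stage_ge st) => [[lE rE]|]; last by right.
  move: lN'; rewrite lE rE /= add1n -gap_top ltNge.
  by case: ns_exit => _ _ ->.
- exact: stage_left st.
- exact: mediant_right_ancestors.
- exact: cnR.
- exact: le_trans (ltW Nhi) (stage_top st).
- by apply: inserted_nonempty xN; rewrite lN.
- move=> x n xt xn; have [nN _|Nn] := leqP n N; first exact: (inserted_mem xt xn nN).
  rewrite ltnNge (cone_exits_ge sp cnR xn) //.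
  by apply: leq_ltn_trans Nn; rewrite leq_addr.
- exact: stage_below st.
- move=> x n xn; rewrite inE => /orP[/eqP nE|nl].
    by case: xn => _ _; rewrite nE gap_le0_neg //; case: cnR.
  exact: le_trans (ltW Nhi) (stage_above st xn nl).
- exact: inserted_sorted.
Qed.

(** The affine function of index N is nonpositive at both ends, hence on the whole interval: every
    remaining point exits at N, and the midpoint shows that there are such points. *)
Lemma stage_final :
  cross (chord A c l.2) (chord A c N) <= 0 ->
  cross (chord A c N) (chord A c r.2) <= 0 ->
  forall n, (exists x, x <= top /\ exits A c x n) <-> n \in inserted.
Proof.
move=> cl cr n; have cn := stage_cone st; have [l0 r0] := stage_pos.
have [cp cq _ _ _] := cn.
have glo : gap A c lo N <= 0.
  by rewrite gap_root ?gt_eqF // pmulr_lle0 // invr_gt0.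
have ghi : gap A c hi N <= 0.
  by rewrite gap_root ?lt_eqF // crossC mulNr -mulrN -invrN pmulr_lle0 // invr_gt0 oppr_gt0.
have gN x : lo < x < hi -> gap A c x N <= 0.
  by move=> /andP[lx xh]; exact: gap_between_le0 lx xh glo ghi.
split=> [[x [xt xn]]|].
  apply: (inserted_mem xt xn); rewrite leqNgt; apply/negP => Nn.
  have lx : lo < x < hi.
    apply: (cone_exits sp cn xn); apply: leq_ltn_trans Nn.
      exact: leq_addr.
    exact: leq_addl.
  case: xn => _ /(_ N) + _; rewrite Nn addn_gt0 l0 /= => /(_ isT).
  by rewrite ltNge gN.
have lh : lo < hi := cone_root_lt cn.
have mid : lo < (lo + hi) / 2 < hi by apply/andP; split; lra.
apply: (inserted_nonempty mid _ (n := n)); split; last exact: gN.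
  by rewrite addn_gt0 l0.
by move=> k kN; apply: cone_gap mid.
Qed.

End Insert.

Lemma final_stage : exists l r sl sr,
  stage l r sl sr /\
  forall n, (exists x, x <= top /\ exits A c x n) <-> n \in inserted l r sl sr.
Proof.
have cpos : 0 < c 1 by rewrite c1.
have [M gapM] := gap_lt0_bounded sp cpos.
(* At the left end of the interval all gaps before l.2 + r.2 are nonnegative, while one of index at
   most M is negative. *)
have bound l r sl sr : stage l r sl sr -> (l.2 + r.2 <= M)%N.
  move=> st; have [n [/andP[n0 nM] gn]] := gapM (gap_zero A c l.2).
  rewrite (leq_trans _ nM) // leqNgt; apply/negP => nN; move: gn.
  by rewrite ltNge (cone_gap_left_ge0 (stage_cone st)) // n0.
suff loop k : forall l r sl sr, (M - (l.2 + r.2) < k)%N -> stage l r sl sr ->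
    exists l r sl sr, stage l r sl sr /\
      forall n, (exists x, x <= top /\ exits A c x n) <-> n \in inserted l r sl sr.
  exact: loop (ltnSn _) initial_stage.
elim: k => [//|k IHk] l r sl sr Mk st.
have [l0 r0] := stage_pos st; have NM := bound _ _ _ _ st.
have [lN|lN] := leP (cross (chord A c l.2) (chord A c (l.2 + r.2))) 0; last first.
  have st' := stage_right_step st lN; apply: (IHk _ _ _ _ _ st').
  by have /= := bound _ _ _ _ st'; clear -Mk NM l0; lia.
have [Nr|Nr] := leP (cross (chord A c (l.2 + r.2)) (chord A c r.2)) 0; last first.
  have st' := stage_left_step st Nr; apply: (IHk _ _ _ _ _ st').
  by have /= := bound _ _ _ _ st'; clear -Mk NM r0; lia.
by exists l, r, sl, sr; split=> //; exact: stage_final.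
Qed.

End Stages.

(** * Recovering a fraction from its list of denominators *)

Section DenominatorLists.
Implicit Types (q l r : fraction).

Lemma parentsE q l r : parents q l r ->
  [/\ q = mediant l r, adjacent l r, (0 < q.2)%N
    & (q.1 * l.2 = l.1 * q.2 + 1 /\ q.1 * r.2 + 1 = r.1 * q.2)%N].
Proof.
case: q l r => m p [lm lp] [rm rp] [[[/= p0 _] _] [[/= l0 _] [/= r0 _]] _ /= det [mE pE]].
have {}det : (rm * lp = (lm * rp).+1)%N by clear -det; lia.
rewrite /mediant /= mE pE; split=> //.
by rewrite -mE -pE; split; clear -det; nia.
Qed.

Lemma eq_of_mod_eq (p a b x y : nat) :
  (a + p * x = b + p * y)%N -> (a < p)%N -> (b < p)%N -> a = b.
Proof.
move=> E ap bp; rewrite -(modn_small ap) -(modn_small bp).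
by rewrite -(modnMDl x a p) -(modnMDl y b p) mulnC addnC E addnC [(y * p)%N]mulnC.
Qed.

(** The denominator of a left parent is the inverse of q.1 modulo q.2, taken between 0 and q.2; the
    other entries follow from it. *)
Lemma parents_unique q l r l' r' :
  parents q l r -> parents q l' r' -> l = l' /\ r = r'.
Proof.
move=> /parentsE[qE [_ l0 r0] q0 [ql _]] /parentsE[qE' [_ l0' r0'] _ [ql' _]].
have [q1 q2] : q.1 = (l.1 + r.1)%N /\ q.2 = (l.2 + r.2)%N by rewrite qE.
have [q1' q2'] : q.1 = (l'.1 + r'.1)%N /\ q.2 = (l'.2 + r'.2)%N by rewrite qE'.
have l2 : l.2 = l'.2.
  apply: (@eq_of_mod_eq q.2 _ _ (l.2 * l'.1) (l'.2 * l.1)).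
  - transitivity (l.2 * (l'.1 * q.2 + 1))%N; first by clear; nia.
    rewrite -ql'; transitivity (l'.2 * (q.1 * l.2))%N; first by clear; nia.
    by rewrite ql; clear; nia.
  - by rewrite q2 -[X in (X < _)%N]addn0 ltn_add2l.
  - by rewrite q2' -[X in (X < _)%N]addn0 ltn_add2l.
have l1 : l.1 = l'.1.
  apply/eqP; rewrite -(eqn_pmul2r q0) -(eqn_add2r 1) -ql -ql' l2; exact/eqP.
have r1 : r.1 = r'.1 by apply/eqP; rewrite -(eqn_add2l l.1) -q1 l1 -q1'.
have r2 : r.2 = r'.2 by apply/eqP; rewrite -(eqn_add2l l.2) -q2 l2 -q2'.
by split; apply: injective_projections.
Qed.

Lemma ancestors_lt (parent : fraction -> fraction -> Prop) stop q s :
  (forall a b, parent a b -> (b.2 < a.2)%N) -> ancestors parent stop q s ->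
  forall a, a \in s -> (a.2 < q.2)%N.
Proof.
move=> dec; elim=> [//|{}q q' {}s _ qq' _ IHs] a.
rewrite inE => /orP[/eqP->|/IHs aq']; first exact: dec.
exact: ltn_trans aq' (dec _ _ qq').
Qed.

Lemma left_parent_lt q l : left_parent q l -> (l.2 < q.2)%N.
Proof.
by case=> r /parentsE[-> [_ _ r0] _ _]; rewrite -[X in (X < _)%N]addn0 ltn_add2l.
Qed.

Lemma right_parent_lt q r : right_parent q r -> (r.2 < q.2)%N.
Proof.
by case=> l /parentsE[-> [_ l0 _] _ _]; rewrite -[X in (X < _)%N]add0n ltn_add2r.
Qed.

Lemma denominator_list_parents n q D :
  q <> (0, 1)%N -> q <> (1, n)%N -> denominator_list q n D ->
  exists l r, [/\ parents q l r, l.2 \in D, r.2 \in D, q.2 \in D &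
    forall k, k \in D -> k = q.2 \/ (k <= maxn l.2 r.2)%N].
Proof.
move=> q0 q1 [ls [rs [als ars ->]]].
case: als q0 => [//|{}q l {}ls _ ql als _] in ars q1 *.
case: ars q1 ql => [//|{}q r {}rs _ qr ars _ ql].
have [[r0 p] [l0 p']] := (ql, qr); have [lE _] := parents_unique p p'.
exists l, r; split.
- by rewrite lE.
- by rewrite mem_cat mem_rev /= inE eqxx.
- by rewrite mem_cat !inE eqxx !orbT.
- by rewrite mem_cat inE eqxx orbT.
- move=> k; rewrite mem_cat mem_rev /= !inE orbCA => /or3P[/eqP|kl|kr]; first by left.
    right; rewrite leq_max; apply/orP; left.
    case/orP: kl => [/eqP ->//|/mapP[a al ->]].
    exact/ltnW/(ancestors_lt left_parent_lt als).
  right; rewrite leq_max; apply/orP; right.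
  case/orP: kr => [/eqP ->//|/mapP[a ar ->]].
  exact/ltnW/(ancestors_lt right_parent_lt ars).
Qed.

Lemma admissible_fraction_bounds n q : (0 < n)%N -> admissible_fraction n q ->
  [/\ q <> (0, 1)%N, q <> (1, n)%N & (q.1 * n < q.2)%N].
Proof.
move=> n0 [[q0 _] /andP[ge lt]]; split.
- by move=> qE; move: ge; rewrite qE fraction_val_le.
- by move=> qE; move: lt; rewrite qE ltxx.
- by move: lt; rewrite fraction_val_lt // mul1n.
Qed.

(* The largest two entries of the list are q.2 and the larger parental
   denominator; they leave only the fractions m/p and (p - m)/p, and the
   second exceeds 1/2. *)
Lemma denominator_list_inj n q q' D D' : (1 < n)%N ->
  admissible_fraction n q -> admissible_fraction n q' ->
  denominator_list q n D -> denominator_list q' n D' ->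
  (forall k, (0 < k)%N -> k \in D <-> k \in D') -> q' = q.
Proof.
move=> n1 /(admissible_fraction_bounds (ltnW n1))[q0 q1 qn].
move=> /(admissible_fraction_bounds (ltnW n1))[q0' q1' qn'].
move=> /(denominator_list_parents q0 q1)[l [r [par lD rD qD maxD]]].
move=> /(denominator_list_parents q0' q1')[l' [r' [par' lD' rD' qD' maxD']]] DD'.
have [qE [_ l0 r0] p0 [ql _]] := parentsE par.
have [qE' [_ l0' r0'] p0' [ql' qr']] := parentsE par'.
have q2 : q.2 = (l.2 + r.2)%N by rewrite qE.
have q2' : q'.2 = (l'.2 + r'.2)%N by rewrite qE'.
have mD : maxn l.2 r.2 \in D by rewrite /maxn; case: ifP.
have mD' : maxn l'.2 r'.2 \in D' by rewrite /maxn; case: ifP.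
have pp : q.2 = q'.2.
  have := maxD' _ (proj1 (DD' _ p0) qD); have := maxD _ (proj2 (DD' _ p0') qD').
  by clear -l0 r0 l0' r0' q2 q2'; lia.
have mm : maxn l.2 r.2 = maxn l'.2 r'.2.
  have m0 : (0 < maxn l.2 r.2)%N by rewrite leq_max l0.
  have m0' : (0 < maxn l'.2 r'.2)%N by rewrite leq_max l0'.
  have := maxD' _ (proj1 (DD' _ m0) mD); have := maxD _ (proj2 (DD' _ m0') mD').
  by clear -l0 r0 l0' r0' q2 q2' pp; lia.
have qlt : (q.1 < q.2)%N by clear -n1 qn; nia.
have qlt' : (q'.1 < q'.2)%N by clear -n1 qn'; nia.
(* Equal sums and equal maxima leave two pairings. In the first, q.1 and q'.1 are both inverse to
   l.2 modulo q.2; in the second they are opposite modulo q.2, which is excluded because both are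
   less than half of it. *)
have [l2|rl] : l'.2 = l.2 \/ r'.2 = l.2 by clear -mm pp q2 q2'; lia.
  apply: injective_projections; last by rewrite pp.
  apply: (@eq_of_mod_eq q.2 _ _ (q'.1 * l.1) (q.1 * l'.1)); last 2 first.
  - by rewrite pp.
  - by [].
  transitivity (q'.1 * (l.1 * q.2 + 1))%N; first by clear; nia.
  rewrite -ql; transitivity (q.1 * (q'.1 * l'.2))%N; first by rewrite l2; clear; nia.
  by rewrite ql' pp; clear; nia.
have : (q.2 %| q.1 + q'.1)%N.
  rewrite -(@dvdn_addr (q.2 * (q'.1 * l.1))) ?dvdn_mulr //.
  suff -> : (q.2 * (q'.1 * l.1) + (q.1 + q'.1) = q.2 * (q.1 * r'.1))%N.
    exact: dvdn_mulr.
  transitivity (q'.1 * (q.1 * l.2) + q.1)%N; first by rewrite ql; clear; nia.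
  transitivity (q.1 * (q'.1 * r'.2 + 1))%N; first by rewrite rl; clear; nia.
  by rewrite qr' pp; clear; nia.
have s0 : (0 < q.1 + q'.1)%N.
  by rewrite addn_gt0; case: (q.1) ql => //; rewrite mul0n addn1.
move=> /(dvdn_leq s0); rewrite leqNgt; case/negP.
by rewrite -pp in qn'; clear -n1 qn qn'; nia.
Qed.

End DenominatorLists.

(** * Return times of the planar map as exit times of the spiral *)

Section Orbit.
Variables (R : realType) (tauL tauR deltaR : R).
Hypotheses (hdelta : 1 < deltaR) (htau : tauR ^+ 2 / 4 < deltaR).

(** Powers of lambda = tauR/2 + i sqrt(deltaR - tauR^2/4), an eigenvalue of the linear part of the
    right branch; |lambda|^2 = deltaR. *)
Definition eigen_power (n : nat) : R * R :=
  iter n (fun z => (tauR / 2 * z.1 - (deltaR - tauR ^+ 2 / 4) * z.2,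
                    z.1 + tauR / 2 * z.2)) (1, 0).
Local Notation A := (fun n => (eigen_power n).1).
Local Notation c := (fun n => (eigen_power n).2).
Local Notation f := (pwl_map tauL tauR deltaR).

Lemma eigen_power_spiral : spiral (deltaR - tauR ^+ 2 / 4) A c.
Proof.
have ADcD m n :
    (eigen_power (m + n)).1 =
      A m * A n - (deltaR - tauR ^+ 2 / 4) * (c m * c n) /\
    (eigen_power (m + n)).2 = A m * c n + c m * A n.
  elim: m => [|m [IH1 IH2]]; first by rewrite /=; split; ring.
  by rewrite addSn /eigen_power /= -!/(eigen_power _) IH1 IH2; split; field.
have normE n : A n ^+ 2 + (deltaR - tauR ^+ 2 / 4) * c n ^+ 2 = deltaR ^+ n.
  elim: n => [|n IHn]; first by rewrite /=; ring.
  by rewrite [RHS]exprS -IHn /eigen_power /= -!/(eigen_power _); field.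
split=> //.
- by rewrite subr_gt0.
- by move=> m n; have [] := ADcD m n.
- by move=> m n; have [] := ADcD m n.
- by move=> n n0; rewrite normE exprn_egt1 // -lt0n.
Qed.

Lemma eigen_power1 : eigen_power 1 = (tauR / 2, 1).
Proof. by rewrite /eigen_power /=; congr pair; ring. Qed.

Lemma gap_recurrence x n :
  gap A c x n.+2 = tauR * gap A c x n.+1 - deltaR * gap A c x n + (1 - tauR + deltaR).
Proof. by rewrite !gapE /eigen_power /= -!/(eigen_power _); field. Qed.

(** Normalised so that the gap of index 1 is (1 - tauR + deltaR) x. By [gap_recurrence], the gap of
    index n + 1 is then the same multiple of the n-th abscissa under the right branch. *)
Definition affine_coord (x : R) : R := (1 - tauR + deltaR) * x - 1 + tauR / 2.

(** The factor is |1 - lambda|^2, and lambda is not real. *)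
Lemma fixed_point_factor_gt0 : 0 < 1 - tauR + deltaR.
Proof.
have : 0 <= (1 - tauR / 2) ^+ 2 by exact: sqr_ge0.
suff -> : (1 - tauR / 2) ^+ 2 = 1 - tauR + tauR ^+ 2 / 4 by move: htau; lra.
by field.
Qed.

Lemma affine_coord1 : affine_coord 1 = top_point (deltaR - tauR ^+ 2 / 4) A c.
Proof. by rewrite /affine_coord /top_point !eigen_power1 /=; field. Qed.

Lemma affine_coord_le x y : (affine_coord x <= affine_coord y) = (x <= y).
Proof. by rewrite !lerD2r ler_pM2l // fixed_point_factor_gt0. Qed.

Lemma affine_coord_lt x y : (affine_coord x < affine_coord y) = (x < y).
Proof. by rewrite !ltrD2r ltr_pM2l // fixed_point_factor_gt0. Qed.

Lemma affine_coord_onto y : exists x, affine_coord x = y.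
Proof.
exists ((y + 1 - tauR / 2) / (1 - tauR + deltaR)).
by rewrite /affine_coord; field; rewrite gt_eqF // fixed_point_factor_gt0.
Qed.

Lemma iter_pwl_map x n :
  (forall k, (0 < k <= n)%N -> 0 < gap A c (affine_coord x) k) ->
  iter n f (x, 0) =
    (gap A c (affine_coord x) n.+1 / (1 - tauR + deltaR),
     - deltaR * (gap A c (affine_coord x) n / (1 - tauR + deltaR))).
Proof.
have K0 := fixed_point_factor_gt0; have Kn : 1 - tauR + deltaR != 0 by rewrite gt_eqF.
elim: n => [_|n IHn pos].
  rewrite !gapE !eigen_power1 /affine_coord /=.
  by congr pair; field.
rewrite iterS IHn; last first.
  by move=> k /andP[k0 kn]; rewrite pos // k0 ltnW.
rewrite /pwl_map leNgt divr_gt0 ?pos //= gap_recurrence.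
by congr pair; field.
Qed.

(** The n-th abscissa has the sign of the gap of index n + 1. If it is nonpositive, the left branch
    gives ordinate 0; otherwise the next ordinate is - deltaR times a positive number. *)
Lemma iter_pwl_map_eq0 x n :
  (forall k, (0 < k <= n)%N -> 0 < gap A c (affine_coord x) k) ->
  (iter n.+1 f (x, 0)).2 = 0 <-> gap A c (affine_coord x) n.+1 <= 0.
Proof.
move=> pos; rewrite iterS iter_pwl_map // /pwl_map /=.
have K0 := fixed_point_factor_gt0.
rewrite pmulr_lle0 ?invr_gt0 //; case: ifPn => // /negbTE gpos; split=> //= /eqP.
have d0 : deltaR != 0 by rewrite gt_eqF // (lt_trans ltr01).
rewrite mulf_eq0 oppr_eq0 (negbTE d0) mulf_eq0 invr_eq0 (gt_eqF K0) orbF => /eqP g0.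
by rewrite g0 lexx in gpos.
Qed.

Lemma return_timeE x n :
  return_time tauL tauR deltaR x n <-> exits A c (affine_coord x) n.
Proof.
split=> [[n0 ret first]|[n0 pos le0]].
(* [iter_pwl_map_eq0] presupposes that all earlier gaps are positive, so positivity has to be gained
   one index at a time. *)
- have pos k : (k < n)%N -> forall j, (0 < j <= k)%N -> 0 < gap A c (affine_coord x) j.
    elim: k => [_ [|j]//|k IHk kn j /andP[j0]].
    rewrite leq_eqVlt => /orP[/eqP ->|jk]; last by apply: (IHk (ltnW kn)); rewrite j0.
    rewrite ltNge; apply/negP => /(iter_pwl_map_eq0 (IHk (ltnW kn))).
    exact: first.
  split=> // [k /andP[k0 kn]|]; first by apply: (pos k); rewrite ?k0 ?leqnn.
  case: n => // n in n0 ret first pos *.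
  by apply/(iter_pwl_map_eq0 (pos n _)).
- split=> // [|k /andP[k0 kn]].
    case: n => // n in n0 pos le0 *.
    by apply/iter_pwl_map_eq0.
  case: k => // k in k0 kn *.
  have posk j : (0 < j <= k)%N -> 0 < gap A c (affine_coord x) j.
    by move=> /andP[j0 jk]; apply: pos; rewrite j0 (leq_ltn_trans jk) // ltnW.
  by move=> /(iter_pwl_map_eq0 posk); rewrite leNgt pos.
Qed.

End Orbit.

(** * Existence of return times, and transfer of the final stage of the descent to the map *)

Lemma exits_exists (R : archiRealFieldType) (kappa : R) (A c : nat -> R) (x : R) :
  spiral kappa A c -> 0 < c 1 -> exists n, exits A c x n.
Proof.
move=> sp c1; have [M /(_ x)[n [/andP[n0 _] gn]]] := gap_lt0_bounded sp c1.
have ex : exists n, (0 < n)%N && (gap A c x n <= 0) by exists n; rewrite n0 ltW.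
exists (ex_minn ex); case: ex_minnP => m /andP[m0 gm] min; split=> // k /andP[k0 km].
by rewrite ltNge; apply/negP => gk; move: km; rewrite ltnNge min // k0.
Qed.

Theorem theorem2p3 (R : realType) (tauR deltaR : R)
    (hdelta : 1 < deltaR) (htau : tauR ^+ 2 / 4 < deltaR) :
  exists nstar : nat,
    (forall tauL : R, return_time tauL tauR deltaR 1 nstar) /\
    exists (q : fraction) (D : seq nat),
      [/\ admissible_fraction nstar q,
          denominator_list q nstar D &
          forall tauL : R,
            [/\ lists_return_times tauL tauR deltaR D,
                (forall (q' : fraction) (D' : seq nat),
                   admissible_fraction nstar q' ->
                   denominator_list q' nstar D' ->
                   lists_return_times tauL tauR deltaR D' ->
                   q' = q),
                [set x : R | x <= 1] `<=`
                  \bigcup_(n in [set n : nat | (0 < n)%N /\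
                                   return_set tauL tauR deltaR n !=set0])
                    return_set tauL tauR deltaR n &
                forall i j : nat, (i < j < size D)%N ->
                  forall x x' : R,
                    return_set tauL tauR deltaR (nth 0%N D i) x ->
                    return_set tauL tauR deltaR (nth 0%N D j) x' ->
                    x < x']].
Proof.
pose A n := (eigen_power tauR deltaR n).1; pose c n := (eigen_power tauR deltaR n).2.
have sp : spiral (deltaR - tauR ^+ 2 / 4) A c := eigen_power_spiral hdelta htau.
have c1 : c 1 = 1 by rewrite /c eigen_power1.
pose top := top_point (deltaR - tauR ^+ 2 / 4) A c.
have top1 : affine_coord tauR deltaR 1 = top := affine_coord1 tauR deltaR.
have le1 x : (affine_coord tauR deltaR x <= top) = (x <= 1).
  by rewrite -top1 (affine_coord_le htau).
have retE tauL x n : return_time tauL tauR deltaR x n <->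
    exits A c (affine_coord tauR deltaR x) n by exact: return_timeE.
have ex x : exists n, exits A c x n.
  by apply: exits_exists sp _; rewrite c1.
have [ns ns_exit] := ex top.
exists ns; split; first by move=> tauL; apply/retE; rewrite top1.
have ns1 := ns_gt1 sp c1 ns_exit.
have [l [r [sl [sr [st final]]]]] := final_stage sp c1 ns_exit.
have [det l0 r0] := stage_adjacent st.
have N0 : (0 < l.2 + r.2)%N by rewrite addn_gt0 l0.
have adm : admissible_fraction ns (mediant l r).
  split; first by split=> //; have [] := adjacent_coprime (adjacent_mediantl (stage_adjacent st)).
  rewrite fraction_val_le // fraction_val_lt ?(ltnW ns1) //= !mul1n.
  by rewrite mulnC (mediant_ge st) (mediant_le sp c1 ns_exit st).
have den : denominator_list (mediant l r) ns (inserted l r sl sr).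
  exists (l :: sl), (r :: sr); split=> //.
    exact: (mediant_left_ancestors sp c1 ns_exit st).
  exact: (mediant_right_ancestors sp c1 ns_exit st).
exists (mediant l r), (inserted l r sl sr); split=> // tauL.
have lists : lists_return_times tauL tauR deltaR (inserted l r sl sr).
  move=> n n0; rewrite -final; split=> [[x [x1 /retE xn]]|[y [ytop yn]]].
    by exists (affine_coord tauR deltaR x); rewrite le1.
  have [x xy] := affine_coord_onto htau y.
  exists x; split; first by rewrite -le1 xy.
  by apply/retE; rewrite xy.
split=> //.
- move=> q' D' adm' den' lists'.
  apply: (denominator_list_inj ns1 adm adm' den den') => k k0.
  by rewrite -(lists k k0) -(lists' k k0).
- move=> x x1; have [n xn] := ex (affine_coord tauR deltaR x).
  have xin : return_set tauL tauR deltaR n x by split=> //; apply/retE.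
  by exists n => //; split; [case: xn | exists x].
- move=> i j /andP[ij jD] x x' [x1 /retE xi] [x1' /retE xj].
  have /(pairwiseP 0%N) sorted := inserted_sorted sp st.
  have /boolp.asboolP := sorted i j (ltn_trans ij jD) jD ij.
  by rewrite -(affine_coord_lt htau); apply; rewrite ?le1.
Qed.
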